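(* Let $N$ be a lattice, $N_{\mathbb R}=N\otimes\mathbb R$, and let $L_0,L_1\subseteq N_{\mathbb R}$ be two finite sets of lattice points with union $L=L_0\cup L_1$ such that $\dim\mathrm{Conv}(L_0)=\dim\mathrm{Conv}(L)$. Let $\mathcal T_0$ be a regular triangulation of $L_0$. Then there is a regular triangulation $\mathcal T$ of $L$ that contains $\mathcal T_0$, in the sense that every simplex $T\in\mathcal T_0$ is also contained in $\mathcal T$, i.e. $\mathcal T_0\subseteq\mathcal T$.
   Context: A triangulation of a finite point set $L$ is a collection of simplices of dimension $\dim\mathrm{Conv}(L)$ with vertices in $L$ (not every point of $L$ need be used), any two meeting in a common face of each, with union $\mathrm{Conv}(L)$. A triangulation $\mathcal T$ of $L$ is regular if there is a weight function $w:L\to\mathbb Q_{\ge0}$ such that the simplices of $\mathcal T$ are exactly the projections to $N_{\mathbb R}$ of the lower facets of $\mathrm{Conv}\{(x,w(x)):x\in L\}\subseteq N_{\mathbb R}\times\mathbb R$; a lower facet is one with an inner normal whose last coordinate is positive (relative to the affine span of $L$ times $\mathbb R$). Equivalently, when $L$ lies on an affine hyperplane not containing $0$, the simplices are obtained by intersecting with $\mathrm{Conv}(L)$ the projections of the lower facets of the cone generated by the $(x,w(x))$. *)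

(* Defs.v *)
From mathcomp Require Import all_boot all_order all_algebra.
From mathcomp Require Import boolp classical_sets cardinality reals convex.

Set Implicit Arguments.
Unset Strict Implicit.
Unset Printing Implicit Defensive.

Import Order.TTheory GRing.Theory Num.Theory.

Local Open Scope classical_set_scope.
Local Open Scope ring_scope.

(* A full-rank lattice N in the real vector space V, that is, N (x) R = V:
   the Z-span of some R-basis of V. *)
Definition is_lattice (R : realType) (V : vectType R) (N : set V) : Prop :=
  exists2 b : (\dim {:V}).-tuple V, basis_of fullv b
    & N = [set v | exists z : 'I_(\dim {:V}) -> int,
                     v = \sum_i tnth b i *~ z i].

Definition hull (R : realType) (V : vectType R) (A : set V) : set V :=
  smallest (@convex_set R V) A.

Definition affinely_independent (R : realType) (V : vectType R) (s : seq V) :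
    bool :=
  if s is x :: s' then free [seq y - x | y <- s'] else true.

(* Affinely independent families in V have at most dim V + 1 members, so the
   bound on k is harmless. *)
Definition affine_rank (R : realType) (V : vectType R) (A : set V) : nat :=
  \max_(k < (\dim {:V}).+2 |
        `[< exists s : seq V, [/\ size s = k, affinely_independent s
                                & [set` s] `<=` A] >]) k.

(* In particular the empty set has dimension -1. *)
Definition affine_dim (R : realType) (V : vectType R) (A : set V) : int :=
  (affine_rank A)%:Z - 1.

(* The face of P with inner normal u. *)
Definition face_of (R : realType) (V : vectType R) (u : 'Hom(V, R^o))
    (P : set V) : set V :=
  [set x | P x /\ forall y, P y -> (u x : R) <= u y].

(* Faces of a polytope; u = 0 gives P itself. *)
Definition is_face (R : realType) (V : vectType R) (F P : set V) : Prop :=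
  F = set0 \/ exists u : 'Hom(V, R^o), F = face_of u P.

Definition is_simplex (R : realType) (V : vectType R) (L S : set V) : Prop :=
  exists s : seq V,
    [/\ affinely_independent s, [set` s] `<=` L & S = hull [set` s]].

(* Simplices are represented by their underlying point sets. *)
Definition triangulation (R : realType) (V : vectType R) (L : set V)
    (T : set (set V)) : Prop :=
  [/\ forall S, T S -> is_simplex L S /\ affine_dim S = affine_dim (hull L),
      forall S S', T S -> T S' ->
        is_face (S `&` S') S /\ is_face (S `&` S') S'
    & \bigcup_(S in T) S = hull L].

Definition lifted (R : realType) (V : vectType R) (L : set V) (w : V -> rat) :
    set (V * R^o)%type :=
  [set (x, ratr (w x) : R^o) | x in L].

(* "Facet" is relative to aff(L) x R, of dimension dim Conv(L) + 1: when the
   lifted points span only a non-vertical hyperplane of it, the whole lifted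
   polytope is its own (unique) lower facet. *)
Definition lower_facet (R : realType) (V : vectType R) (L : set V)
    (w : V -> rat) (F : set (V * R^o)%type) : Prop :=
  exists u : 'Hom((V * R^o)%type, R^o),
    [/\ (0 : R) < u (0, 1),
        F = face_of u (hull (lifted L w))
      & affine_dim F = affine_dim (hull L)].

Definition regular_triangulation (R : realType) (V : vectType R) (L : set V)
    (T : set (set V)) : Prop :=
  triangulation L T /\
  exists2 w : V -> rat, (forall x, L x -> 0 <= w x)
    & T = [set fst @` F | F in lower_facet L w].

(* Main.v *)
Require Import Defs.
From HB Require Import structures.
From mathcomp Require Import all_boot all_order all_algebra.
From mathcomp Require Import boolp classical_sets cardinality reals convex.
From mathcomp Require Import interval_inference ring.

(** The points of [L1] that are not in [L0] are added one at a time, each with a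
    very large weight (a placing triangulation). Equality of dimensions puts
    them in the affine span of [L0].

    Lower facets are handled through affine functions. An affine function [g]
    with [g <= w] on the finite set [s] touches [w] on some subset of [s]; it is
    a facet function when that subset spans the same affine space as [s]. The
    convex hulls of these subsets, here called cells, are exactly the projected
    lower facets ([lower_facet_cells]). Affine functions on [V] are linear
    functionals on [V * R] evaluated at [(x, 1)], which turns affine
    independence and affine rank into freeness and dimension of spans.

    Raising is the basic move: a minorant [g] that touches [w] on too small a set
    can be moved along an affine function vanishing on that set until it meets
    a new point, without lowering its value at a chosen point [x] of the hull
    ([raise_to_facet]).

    When all cells are simplices they form a triangulation
    ([regular_triangulation_cells]). Two cells meet where two minorants agree,
    which is a face of both ([cell_cap_face]). They cover the hull because the
    facet function [g] with the largest value at [x] has [x] in its cell: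
    otherwise a barycentric coordinate of the cell is negative at [x], and
    moving [g] against it and then raising would give a larger value
    ([cells_cover]).

    Let now [p] be a new point whose weight exceeds the values at [p] of all
    facet functions of [s], which are finite in number. The old facet functions
    stay below the weights and keep their cells. A new cell is the join of [p]
    with the hull of a touching set [G] in [s]. By raising, [G] lies in an old
    simplex, where it is cut out by a supporting hyperplane, so its hull is a
    face of that simplex; and [p] is not in the affine span of [G], since
    otherwise the function would already be a facet function of [s]. Hence the
    new cell is a simplex ([simplicial_cons]), and induction on the list of new
    points ([simplicial_extension]) ends the proof. *)

Set Implicit Arguments.
Unset Strict Implicit.
Unset Printing Implicit Defensive.

Import Order.TTheory GRing.Theory Num.Theory.

Local Open Scope classical_set_scope.
Local Open Scope ring_scope.

(** * Convex hulls of finite sets, in homogeneous coordinates *)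

Section Homogenization.
Variables (R : realType) (V : vectType R).
Implicit Types (s t : seq V) (x y : V).
Local Notation W := (V * R^o)%type.

(** The embedding of [V] at height one, under which affine combinations become
    linear ones. *)
Definition homog x : W := (x, 1).

(** Every affine function on [V] has this form. *)
Definition affv (g : 'Hom(W, R^o)) x : R := g (homog x).

Lemma affvD g h x : affv (g + h) x = affv g x + affv h x.
Proof. by rewrite /affv add_lfunE. Qed.

Lemma affvN g x : affv (- g) x = - affv g x.
Proof. by rewrite /affv opp_lfunE. Qed.

Lemma affvZ a g x : affv (a *: g) x = a * affv g x.
Proof. by rewrite /affv scale_lfunE. Qed.

Definition affvE := (affvD, affvN, affvZ).

Lemma homog_sum s (c : V -> R) :
  \sum_(v <- s) c v *: homog v = (\sum_(v <- s) c v *: v, \sum_(v <- s) c v).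
Proof.
elim: s => [|v s IH]; first by rewrite !big_nil.
rewrite !big_cons IH; congr pair.
by rewrite /= /GRing.scale /= mulr1.
Qed.

Lemma affv_sum g s x (c : V -> R) :
  homog x = \sum_(v <- s) c v *: homog v ->
  affv g x = \sum_(v <- s) c v * affv g v.
Proof.
by move=> xE; rewrite /affv xE linear_sum; apply: eq_bigr => v _; rewrite linearZ.
Qed.

(** Normalizing by the total weight lets the induction remove one point
    without keeping the weights of sum one. *)
Lemma convex_combination_mem (C : set V) s (c : V -> R) :
  convex_set C -> [set` s] `<=` C -> (forall v, 0 <= c v) ->
  0 < \sum_(v <- s) c v ->
  C ((\sum_(v <- s) c v)^-1 *: \sum_(v <- s) c v *: v).
Proof.
move=> cvxC + c0; elim: s => [|v s IH] sC; first by rewrite big_nil ltxx.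
rewrite !big_cons; set k := \sum_(_ <- _) c _; set q := \sum_(_ <- _) c _ *: _.
have Cv : C v by apply: sC; rewrite /= mem_head.
have sC' : [set` s] `<=` C by move=> y ys; apply: sC; rewrite /= inE ys orbT.
have k_ge0 : 0 <= k by exact: sumr_ge0.
move=> K_gt0; have [k0|k_neq0] := eqVneq k 0.
  have -> : q = 0.
    rewrite /q big_seq big1 // => y ys.
    have := k0; rewrite /k => /eqP; rewrite psumr_eq0 // => /allP /(_ _ ys).
    by move=> /eqP ->; rewrite scale0r.
  move: K_gt0; rewrite k0 !addr0 => cv0.
  by rewrite scalerA mulVf ?scale1r // gt_eqF.
have k_gt0 : 0 < k by rewrite lt_def k_neq0.
have Cq := IH sC' k_gt0.
have l0 : 0 <= c v / (c v + k) by rewrite divr_ge0 // ltW.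
have l1 : c v / (c v + k) <= 1 by rewrite ler_pdivrMr // mul1r lerDl.
have := cvxC v (k^-1 *: q) (Itv01 l0 l1); rewrite !inE => /(_ Cv Cq).
congr (C _); rewrite /conv /= /unstable.onem !scalerA scalerDr scalerA.
congr (_ *: _ + _ *: _); first by rewrite mulrC.
field.
by rewrite k_neq0 gt_eqF.
Qed.

(** One equation in [V * R] encodes both the combination and the condition that
    its coefficients add up to one. *)
Lemma hull_seqP s x : hull [set` s] x <->
  exists c : V -> R, (forall v, 0 <= c v) /\
    homog x = \sum_(v <- s) c v *: homog v.
Proof.
split; last first.
  move=> [c [c0]]; rewrite homog_sum => -[-> /esym c1] C [cvxC sC].
  have := convex_combination_mem cvxC sC c0.
  by rewrite c1 invr1 scale1r; apply; exact: ltr01.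
apply: (@smallest_sub _ _ _ [set y | exists c : V -> R, _ ]).
- move=> y z l; rewrite !inE /= => -[c [c0 yE]] [d [d0 zE]].
  exists (fun v => l%:num * c v + (1 - l%:num) * d v); split.
    by move=> v; rewrite addr_ge0 // mulr_ge0 // subr_ge0.
  rewrite (eq_bigr (fun v => l%:num *: (c v *: homog v)
                             + (1 - l%:num) *: (d v *: homog v))); last first.
    by move=> v _; rewrite !scalerA -scalerDl.
  rewrite big_split -!scaler_sumr -yE -zE /homog /=; congr pair.
  by rewrite /= -scalerDl addrC subrK scale1r.
- move=> y /= ys.
  (* s may list y several times, hence the division by its multiplicity *)
  exists (fun v => (v == y)%:R / (count_mem y s)%:R); split.
    by move=> v; rewrite divr_ge0.
  have cnt : (count_mem y s)%:R != 0 :> R.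
    by rewrite pnatr_eq0 -lt0n -has_count has_pred1.
  rewrite (bigID (pred1 y)) /= [X in _ + X]big1 ?addr0; last first.
    by move=> v /negPf ->; rewrite mul0r scale0r.
  rewrite (eq_bigr (fun=> (count_mem y s)%:R^-1 *: homog y)); last first.
    by move=> v /eqP ->; rewrite eqxx mul1r.
  by rewrite big_const_seq iter_addr_0 -scaler_nat scalerA divff ?scale1r.
Qed.

Lemma hull_convex (A : set V) : convex_set (hull A).
Proof.
move=> x y l; rewrite !inE => Ax Ay C AC; have [cvxC _] := AC.
by have := cvxC x y l; rewrite !inE; apply; [apply: Ax | apply: Ay].
Qed.

Lemma hull_sub (A B : set V) : A `<=` hull B -> hull A `<=` hull B.
Proof. by move=> AB; apply: smallest_sub => //; exact: hull_convex. Qed.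

Lemma sub_hull (A : set V) : A `<=` hull A.
Proof. exact: sub_smallest. Qed.

Lemma hullS (A B : set V) : A `<=` B -> hull A `<=` hull B.
Proof. by move=> AB; apply: hull_sub => x /AB; exact: sub_hull. Qed.

Lemma affv_hull_ge0 g s x :
  {in s, forall v, 0 <= affv g v} -> hull [set` s] x -> 0 <= affv g x.
Proof.
move=> g0 /hull_seqP[c [c0 /affv_sum ->]]; rewrite big_seq.
by apply: sumr_ge0 => v vs; rewrite mulr_ge0 ?g0.
Qed.

(** A point of a polytope on a supporting hyperplane is a convex combination of
    the generators on that hyperplane, since the other generators, being
    strictly on one side, must have coefficient zero. *)
Lemma hull_zero_face g s x :
  {in s, forall v, 0 <= affv g v} -> hull [set` s] x -> affv g x = 0 ->
  hull [set` [seq v <- s | affv g v == 0]] x.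
Proof.
move=> g0 /hull_seqP[c [c0 xE]]; rewrite (affv_sum _ xE) big_seq => /eqP.
rewrite psumr_eq0; last by move=> v vs; rewrite mulr_ge0 ?g0.
move=> /allP cg0; apply/hull_seqP; exists c; split=> //.
rewrite xE big_filter [RHS]big_mkcond; apply: eq_big_seq => v vs.
have := cg0 v vs; rewrite vs /= mulf_eq0.
by case: (affv g v =P 0) => //; rewrite orbF => _ /eqP ->; rewrite scale0r.
Qed.

Lemma hull_span s x :
  hull [set` s] x -> homog x \in <<[seq homog v | v <- s]>>%VS.
Proof.
move=> /hull_seqP[c [_ ->]]; rewrite big_seq; apply: memv_suml => v vs.
by apply/memvZ/memv_span/map_f.
Qed.

Lemma hull_sub_span s t : [set` s] `<=` hull [set` t] ->
  (<<[seq homog v | v <- s]>> <= <<[seq homog v | v <- t]>>)%VS.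
Proof.
move=> st; apply/span_subvP => _ /mapP[v vs ->].
by apply: hull_span; apply: st.
Qed.

Lemma sub_homog_span s t : {subset s <= t} ->
  (<<[seq homog v | v <- s]>> <= <<[seq homog v | v <- t]>>)%VS.
Proof. by move=> st; apply: sub_span; apply: sub_map. Qed.

End Homogenization.

Lemma separating_functional (R : realType) (W : vectType R)
    (U : {vspace W}) (v : W) : v \notin U ->
  exists h : 'Hom(W, R^o), {in U, forall u, h u = 0} /\ h v = 1.
Proof.
move=> vU; have bU := vbasisP U.
have frX : free (v :: vbasis U).
  by rewrite free_cons (span_basis bU) vU (basis_free bU).
pose fX : seq R^o := 1 :: nseq (size (vbasis U)) 0.
have [f fE] := linear_of_free (v :: vbasis U) fX.
have szX : size fX = size (v :: vbasis U) by rewrite /= size_nseq.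
have [fv fU] := fE frX szX.
exists (linfun f); split; last by rewrite lfunE.
have sub : (<<vbasis U>> <= lker (linfun f))%VS.
  apply/span_subvP => u uU; rewrite memv_ker lfunE /=.
  have := map_f f uU; rewrite fU => /nseqP[-> _]; exact: eqxx.
move=> u; rewrite -(span_basis bU) => /(subvP sub).
by rewrite memv_ker => /eqP.
Qed.

Section Simplex.
Variables (R : realType) (V : vectType R).
Implicit Types (s t : seq V) (x y : V).

(** The separating function is the barycentric coordinate of a vertex for which
    [x] has a negative coefficient. *)
Lemma simplex_separation t x : free [seq homog v | v <- t] ->
  homog x \in <<[seq homog v | v <- t]>>%VS -> ~ hull [set` t] x ->
  exists k : 'Hom((V * R^o)%type, R^o),
    (forall a, hull [set` t] a -> 0 <= affv k a) /\ affv k x < 0.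
Proof.
move=> frt xt ntx; have [c xE _] := free_span frt xt.
rewrite big_map in xE.
have [c0|/allPn[v0 v0t]] := boolP (all (fun v => 0 <= c (homog v)) t).
  case: ntx; apply/hull_seqP; exists (fun v => `|c (homog v)|); split=> //.
  rewrite xE; apply: eq_big_seq => v vt.
  by rewrite ger0_norm //; apply: (allP c0).
rewrite -ltNge => cv0.
have tE := perm_to_rem v0t.
have frt' : free [seq homog v | v <- v0 :: rem v0 t].
  by rewrite -(perm_free (perm_map _ tE)).
have [|h [h0 h1]] := @separating_functional _ _
    <<[seq homog v | v <- rem v0 t]>> (homog v0).
  by move: frt'; rewrite free_cons => /andP[].
have hrem v : v \in rem v0 t -> affv h v = 0.
  by move=> vr; apply/h0/memv_span/map_f.
exists h; split.
  move=> a; apply: affv_hull_ge0 => v; rewrite (perm_mem tE) inE.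
  by move=> /orP[/eqP ->|/hrem -> //]; rewrite /affv h1.
rewrite (affv_sum _ xE) (perm_big _ tE) big_cons big_seq big1; last first.
  by move=> v /hrem ->; rewrite mulr0.
by rewrite /affv h1 mulr1 /= addr0.
Qed.

End Simplex.

(** * Affine minorants of a weight function *)

Lemma seq_argmin (R : realDomainType) (T : eqType) (f : T -> R) (P : pred T)
    (s : seq T) : has P s ->
  exists q, [/\ q \in s, P q & {in s, forall p, P p -> f q <= f p}].
Proof.
elim: s => //= a s IH; have [/IH[q [qs Pq qmin]] _|nPs] := boolP (has P s).
- have [Pa|nPa] := boolP (P a); last first.
    exists q; split=> //; first by rewrite inE qs orbT.
    by move=> p; rewrite inE => /orP[/eqP ->|/qmin//]; rewrite (negPf nPa).
  have [le|lt] := leP (f a) (f q).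
    exists a; split=> //; first exact: mem_head.
    move=> p; rewrite inE => /orP[/eqP -> //|ps] Pp.
    by apply: le_trans le _; apply: qmin.
  exists q; split=> //; first by rewrite inE qs orbT.
  by move=> p; rewrite inE => /orP[/eqP -> _|/qmin//]; apply: ltW.
- rewrite orbF => Pa; exists a; split=> //; first exact: mem_head.
  move=> p; rewrite inE => /orP[/eqP -> //|ps] Pp.
  by case/negP: nPs; apply/hasP; exists p.
Qed.

Lemma seq_max_attained (R : realDomainType) (P : R -> Prop) (vals : seq R) :
  (exists r, P r) -> (forall r, P r -> r \in vals) ->
  exists m, P m /\ forall r, P r -> r <= m.
Proof.
move=> [r0 Pr0] Pv.
have [|m [_ /asboolP Pm mmax]] := @seq_argmin R R (fun r => - r) (fun r => `[< P r >]) vals.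
  by apply/hasP; exists r0; [exact: Pv | exact/asboolP].
exists m; split=> // r Pr; rewrite -lerN2.
by apply: mmax; [exact: Pv | exact/asboolP].
Qed.

(** The next two lemmas give access to functionals on a product: they are the
    sums of a functional on [V] and a multiple of the last coordinate. *)
Lemma hom_prodE (R : realType) (V : vectType R)
    (u : 'Hom((V * R^o)%type, R^o)) :
  exists l : 'Hom(V, R^o), forall x t, u (x, t) = l x + t * u (0, 1).
Proof.
have lin : linear (fun x : V => u (x, 0)).
  move=> a x y; rewrite -linearP; congr (u _); congr pair.
  by rewrite /= addr0 scaler0.
pose flM := GRing.isLinear.Build _ _ _ _ (fun x : V => u (x, 0)) lin.
pose fL : {linear _ -> _} := HB.pack (fun x : V => u (x, 0)) flM.
exists (linfun fL) => x t; rewrite lfunE /=.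
rewrite -[t * _]/(t *: u (0, 1)) -linearZ -linearD; congr (u _); congr pair.
  by rewrite /= scaler0 addr0.
by rewrite /= add0r [RHS]mulr1.
Qed.

Lemma hom_prod_exists (R : realType) (V : vectType R)
    (l : 'Hom(V, R^o)) (b : R) :
  exists u : 'Hom((V * R^o)%type, R^o), forall x t, u (x, t) = l x + t * b.
Proof.
pose f (z : V * R^o) : R^o := l z.1 + z.2 * b.
have lin : linear f.
  move=> a x y; rewrite /f /= linearP scalerDr addrACA mulrDl.
  by rewrite -!mulrA.
pose flM := GRing.isLinear.Build _ _ _ _ f lin.
pose fL : {linear _ -> _} := HB.pack f flM.
by exists (linfun fL) => x t; rewrite lfunE.
Qed.

Section Cells.
Variables (R : realType) (V : vectType R).
Implicit Types (s t : seq V) (x p q : V) (w : V -> R).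
Local Notation W := (V * R^o)%type.
Implicit Types (g h : 'Hom(W, R^o)).

Definition below s w g := {in s, forall p, affv g p <= w p}.

Definition touching s w g := [seq p <- s | affv g p == w p].

(** The touching set spans the same affine space as [s], so that the part of the
    graph of [g] over its hull is a lower facet. *)
Definition facet_fn s w g := below s w g /\
  <<[seq homog p | p <- touching s w g]>>%VS = <<[seq homog p | p <- s]>>%VS.

Definition cell s w g := hull [set` touching s w g].

Lemma touching_sub s w g : {subset touching s w g <= s}.
Proof. by move=> p; rewrite mem_filter => /andP[]. Qed.

Lemma touchingP s w g p : p \in touching s w g -> affv g p = w p.
Proof. by rewrite mem_filter => /andP[/eqP]. Qed.

(** The step [e] is the least ratio of the gap [w - g] to [h] among the points
    where [h] is positive. *)
Lemma push_until_contact s w g h : below s w g ->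
  has (fun p => 0 < affv h p) s ->
  exists e q, [/\ 0 <= e, below s w (g + e *: h), q \in s, 0 < affv h q
                & affv (g + e *: h) q = w q].
Proof.
move=> gw /(seq_argmin (fun p => (w p - affv g p) / affv h p))[q [qs hq qmin]].
have e0 : 0 <= (w q - affv g q) / affv h q.
  by rewrite divr_ge0 ?subr_ge0 ?gw // ltW.
exists ((w q - affv g q) / affv h q), q; split=> //; last first.
  by rewrite !affvE divfK ?gt_eqF // addrC subrK.
move=> p ps; rewrite !affvE; have [hp|hp] := ltP 0 (affv h p); last first.
  apply: le_trans (gw p ps); rewrite gerDl mulr_ge0_le0 //.
by rewrite -lerBrDl -ler_pdivlMr //; apply: qmin.
Qed.

(** If the points touched by [g] do not span, some affine function [h] vanishes
    on them but not everywhere, and its sign can be chosen so that moving [g]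
    along [h] does not lower the value at [x] and eventually meets a new point. *)
Lemma raise_step s w g x : below s w g -> hull [set` s] x ->
  <<[seq homog p | p <- touching s w g]>>%VS <> <<[seq homog p | p <- s]>>%VS ->
  exists g', [/\ below s w g', affv g x <= affv g' x,
    {subset touching s w g <= touching s w g'} &
    (\dim <<[seq homog p | p <- touching s w g]>> <
     \dim <<[seq homog p | p <- touching s w g']>>)%N].
Proof.
set U := <<[seq homog p | p <- touching s w g]>>%VS => gw xs neq.
have leUs : (U <= <<[seq homog p | p <- s]>>)%VS.
  by apply: sub_homog_span; exact: touching_sub.
have [p0 p0s p0U] : exists2 p, p \in s & homog p \notin U.
  apply: contrapT => H; apply: neq; apply/eqP; rewrite eqEsubv leUs /=.
  apply/span_subvP => _ /mapP[p ps ->]; apply: contrapT => /negP nU.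
  by apply: H; exists p.
have [h [h0 h1]] := separating_functional p0U.
(* If h x < 0 use - h: it is positive somewhere on s, since otherwise h would
   be nonnegative on the hull. If h x >= 0, h itself is positive at p0. *)
have [k [k0 kx kpos]] : exists k : 'Hom(W, R^o), [/\ {in U, forall u, k u = 0},
    0 <= affv k x & has (fun p => 0 < affv k p) s].
  have kneg (k : 'Hom(W, R^o)) : {in U, forall u, k u = 0} ->
      {in U, forall u, (- k) u = 0}.
    by move=> k0 u /k0; rewrite opp_lfunE => ->; rewrite oppr0.
  have hpos : has (fun p => 0 < affv h p) s.
    by apply/hasP; exists p0 => //; rewrite /affv h1 ltr01.
  have [hx|hx] := leP 0 (affv h x); first by exists h.
  exists (- h); split; [exact: kneg | by rewrite affvN oppr_ge0 ltW |].
  apply/negPn/negP => /hasPn H.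
  have : 0 <= affv h x.
    apply: affv_hull_ge0 xs => v /H.
    by rewrite affvN oppr_gt0 -leNgt.
  by rewrite leNgt hx.
have [e [q [e0 gw' qs kq gq]]] := push_until_contact gw kpos.
have sub : {subset touching s w g <= touching s w (g + e *: k)}.
  move=> p pt; rewrite mem_filter (touching_sub pt) andbT !affvE.
  have -> : affv k p = 0 by apply/k0/memv_span/map_f.
  by rewrite mulr0 addr0 (touchingP pt).
exists (g + e *: k); split=> //.
  by rewrite !affvE lerDl mulr_ge0.
rewrite ltn_neqAle dimvS ?sub_homog_span // andbT.
rewrite (dimv_leqif_eq (sub_homog_span sub)).
apply/eqP => eqU; have : homog q \in U.
  by rewrite /U eqU memv_span // map_f // mem_filter gq eqxx.
by move=> /k0; move: kq; rewrite /affv => /gt_eqF /eqP.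
Qed.

Lemma raise_to_facet s w g x : below s w g -> hull [set` s] x ->
  exists g', [/\ facet_fn s w g', affv g x <= affv g' x
               & {subset touching s w g <= touching s w g'}].
Proof.
have [n] := ubnP (\dim <<[seq homog p | p <- s]>>
                  - \dim <<[seq homog p | p <- touching s w g]>>)%N.
elim: n g => // n IH g ltn gw xs.
have [eqU|neqU] := pselect (<<[seq homog p | p <- touching s w g]>>%VS
                          = <<[seq homog p | p <- s]>>%VS).
  by exists g; split.
have [g1 [gw1 gx1 sub1 dim1]] := raise_step gw xs neqU.
have [|g2 [f2 gx2 sub2]] := IH g1 _ gw1 xs.
  rewrite -ltnS; apply: leq_trans ltn; rewrite ltnS ltn_sub2l //.
  apply: leq_trans dim1 _; apply: dimvS; apply: sub_homog_span.
  exact: touching_sub.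
exists g2; split=> //; first exact: le_trans gx1 gx2.
by move=> p /sub1/sub2.
Qed.

Lemma exists_below s w : exists g, below s w g.
Proof.
have [->|sn] := eqVneq s [::]; first by exists 0.
have [|q [qs _ qmin]] := @seq_argmin _ _ w predT s.
  by rewrite has_predT lt0n size_eq0.
have [g gE] := @hom_prod_exists _ V 0 (w q).
by exists g => p ps; rewrite /affv gE lfunE add0r mul1r qmin.
Qed.

(** A facet function is determined on the span of the points by the set of
    points it touches, and there are finitely many such sets. *)
Lemma facet_fn_values_finite s w x :
  homog x \in <<[seq homog p | p <- s]>>%VS ->
  exists vals : seq R, forall g, facet_fn s w g -> affv g x \in vals.
Proof.
move=> xs.
pose P (m : (size s).-tuple bool) r :=
  exists g, [/\ facet_fn s w g, touching s w g = mask m s & affv g x = r].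
exists [seq xget 0 (P m) | m <- enum {: (size s).-tuple bool}] => g fg.
pose m := map_tuple (fun p => affv g p == w p) (in_tuple s).
have mE : touching s w g = mask m s by rewrite /touching filter_mask.
have Pm : P m (affv g x) by exists g.
apply/mapP; exists m; first exact: mem_enum.
case: xgetP => [r -> [g' [[g'w fg'] mE' <-]]|/(_ (affv g x)) //].
have : {in [seq homog p | p <- touching s w g'], g =1 g'}; last first.
  by move=> /span_lfunP; apply; rewrite fg'.
move=> _ /mapP[p pt ->]; have := pt; rewrite mE' -mE => pt'.
exact: etrans (touchingP pt') (esym (touchingP pt)).
Qed.

Lemma best_facet_fn s w x : hull [set` s] x ->
  exists2 g, facet_fn s w g & forall h, facet_fn s w h -> affv h x <= affv g x.
Proof.
move=> xs; have [vals valsP] := facet_fn_values_finite w (hull_span xs).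
have [g0 gw0] := exists_below s w; have [g1 [f1 _ _]] := raise_to_facet gw0 xs.
have [||_ [[g fg <-] gmax]] :=
  @seq_max_attained _ [set affv g x | g in facet_fn s w] vals.
- by exists (affv g1 x), g1.
- by move=> _ [g fg <-]; exact: valsP.
by exists g => // h fh; apply: gmax; exists h.
Qed.

(** * Cells that are simplices form a triangulation *)

Definition simplicial s w := forall g, facet_fn s w g ->
  exists t, [/\ {subset t <= s}, free [seq homog v | v <- t]
              & cell s w g = hull [set` t]].

(** At [x], the facet function [g] of largest value has [x] in its cell:
    otherwise some barycentric coordinate [k] of the cell is negative at [x],
    and [g - e *: k] is a minorant for some [e > 0] with a larger value at [x]. *)
Lemma cells_cover s w x : simplicial s w -> hull [set` s] x ->
  exists2 g, facet_fn s w g & cell s w g x.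
Proof.
move=> simp xs; have [g fg gmax] := best_facet_fn w xs.
exists g => //; have [gw gspan] := fg.
have [t [ts frt cE]] := simp g fg.
have tg : {in touching s w g, forall p, hull [set` t] p}.
  by move=> p pt; rewrite -cE; apply: sub_hull.
rewrite cE; apply: contrapT => nxt.
have xt : homog x \in <<[seq homog v | v <- t]>>%VS.
  apply: (subvP (hull_sub_span tg)).
  by rewrite gspan hull_span.
have [k [k0 kx]] := simplex_separation frt xt nxt.
have [|e [q [e0 gw' qs kq gq]]] := @push_until_contact s w g (- k) gw.
  apply/negPn/negP => /hasPn H.
  suff : 0 <= affv k x by rewrite leNgt kx.
  by apply: affv_hull_ge0 xs => v /H; rewrite affvN oppr_gt0 -leNgt.
have [g2 [f2 gx2 _]] := raise_to_facet gw' xs.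
have /(le_trans gx2) := gmax _ f2.
rewrite !affvE gerDl mulrN oppr_le0 nmulr_lge0 // => e0'.
(* With e = 0 the point of contact q is in the touching set of g, on whose
   hull k is nonnegative. *)
have eE : e = 0 by apply/le_anti; rewrite e0 e0'.
move: gq kq; rewrite eE scale0r addr0 affvN oppr_gt0 => gq; rewrite ltNge k0 //.
by apply: tg; rewrite mem_filter gq eqxx.
Qed.

(** Both functions are lower bounds for the weights, so they agree on a cell
    exactly where the other one also reaches the lower envelope. *)
Lemma cell_cap s w g g' x : below s w g -> below s w g' -> cell s w g x ->
  cell s w g' x <-> affv g x = affv g' x.
Proof.
have ge (f f' : 'Hom(W, R^o)) : below s w f' ->
    {in touching s w f, forall p, 0 <= affv (f - f') p}.
  move=> fw p pt; rewrite !affvE (touchingP pt) subr_ge0.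
  by apply: fw; exact: touching_sub pt.
move=> gw gw' xg; split=> [xg'|eqg].
  apply/le_anti/andP; split; rewrite -subr_ge0 -affvN -affvD.
    exact: affv_hull_ge0 (ge _ _ gw) xg'.
  exact: affv_hull_ge0 (ge _ _ gw') xg.
have := hull_zero_face (ge _ _ gw') xg.
rewrite !affvE eqg subrr => /(_ erefl); apply: hullS => p /=.
rewrite mem_filter !affvE subr_eq0 => /andP[/eqP eqp pt].
by rewrite mem_filter -eqp (touchingP pt) eqxx (touching_sub pt).
Qed.

Lemma cell_cap_face s w g g' : below s w g -> below s w g' ->
  is_face (cell s w g `&` cell s w g') (cell s w g).
Proof.
move=> gw gw'.
have [[z [zg zg']]|ne] :=
  pselect (exists z, (cell s w g `&` cell s w g') z); last first.
  by left; apply/seteqP; split=> // z zI; apply: ne; exists z.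
right; have [l lE] := hom_prodE (g - g').
have lg x : affv g x - affv g' x = l x + (g - g') (0, 1).
  by rewrite -affvN -affvD /affv lE mul1r.
have eq0 x : cell s w g x ->
    cell s w g' x <-> l x = - (g - g') (0, 1).
  move=> xg; rewrite (cell_cap gw gw' xg); split=> H; apply/eqP.
    by rewrite -addr_eq0 -lg H subrr.
  by rewrite -subr_eq0 lg H addNr.
have lge x : cell s w g x -> - (g - g') (0, 1) <= l x.
  move=> xg; rewrite -subr_ge0 opprK -lg -affvN -affvD.
  apply: affv_hull_ge0 xg => p pt; rewrite !affvE (touchingP pt) subr_ge0.
  by apply: gw'; exact: touching_sub pt.
exists l; apply/seteqP; split=> x [xg].
  by move=> /(eq0 _ xg) lx; split=> // y /lge; rewrite lx.
move=> xmin; split=> //; apply/(eq0 _ xg)/le_anti.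
by rewrite lge // andbT -((eq0 _ zg).1 zg'); exact: xmin.
Qed.

End Cells.

(** * Adding a point of large weight *)

Section AddPoint.
Variables (R : realType) (V : vectType R).
Implicit Types (s t l : seq V) (x p q : V) (w : V -> R).
Local Notation W := (V * R^o)%type.
Implicit Types (g h : 'Hom(W, R^o)).

Lemma eq_touching s w w' g : {in s, w =1 w'} ->
  touching s w g = touching s w' g.
Proof. by move=> eqw; apply: eq_in_filter => p /eqw ->. Qed.

Lemma eq_facet_fn s w w' g : {in s, w =1 w'} ->
  facet_fn s w g -> facet_fn s w' g.
Proof.
move=> eqw [gw gspan]; split; last by rewrite -(eq_touching _ eqw).
by move=> p ps; rewrite -eqw ?gw.
Qed.

Lemma eq_simplicial s w w' : {in s, w =1 w'} ->
  simplicial s w -> simplicial s w'.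
Proof.
move=> eqw simp g fg; rewrite /cell -(eq_touching _ eqw); apply: simp.
by apply: eq_facet_fn fg => p ps; rewrite eqw.
Qed.

Lemma homog_span_cons p s :
  homog p \in <<[seq homog q | q <- s]>>%VS ->
  <<[seq homog q | q <- p :: s]>>%VS = <<[seq homog q | q <- s]>>%VS.
Proof. by move=> ps; rewrite /= span_cons; apply/addv_idPr; rewrite -memvE. Qed.

Lemma facet_fn_cons s w p g :
  homog p \in <<[seq homog q | q <- s]>>%VS -> affv g p < w p ->
  facet_fn (p :: s) w g <-> facet_fn s w g.
Proof.
move=> ps gp; rewrite /facet_fn homog_span_cons //= (lt_eqF gp).
split=> -[gw ->]; split=> // q; first by move=> qs; apply: gw; rewrite inE qs orbT.
by rewrite inE => /orP[/eqP ->|/gw//]; exact: ltW.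
Qed.

Lemma cell_cons s w p g : affv g p < w p -> cell (p :: s) w g = cell s w g.
Proof. by move=> gp; rewrite /cell /= (lt_eqF gp). Qed.

(** Two generating sets of the same polytope have the same hull on each
    supporting hyperplane. When [t] lists the vertices of a simplex, this shows
    that the part of [s] on the hyperplane spans a face of the simplex. *)
Lemma simplex_face s t h :
  hull [set` s] = hull [set` t] -> {in s, forall v, 0 <= affv h v} ->
  hull [set` [seq v <- s | affv h v == 0]] =
  hull [set` [seq v <- t | affv h v == 0]].
Proof.
move=> st h0.
have h0' : {in t, forall v, 0 <= affv h v}.
  move=> v vt; apply: affv_hull_ge0 h0 _.
  by rewrite st; apply: sub_hull.
apply/seteqP; split; apply: hull_sub => v /=;
  rewrite mem_filter => /andP[/eqP hv vs]; apply: hull_zero_face => //.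
  by rewrite -st; apply: sub_hull.
by rewrite st; apply: sub_hull.
Qed.

(** A new cell through [p] is the join of [p] with the hull of [G], the points
    of [s] touched by [g]. Raising [g] gives an old simplex that contains [G],
    and the two functions agree on a face of it; [p] is outside the affine span
    of [G], or else [g] would be a facet function of [s] with [g p = w p]. *)
Lemma simplicial_cons s w p :
  homog p \in <<[seq homog q | q <- s]>>%VS ->
  (forall g, facet_fn s w g -> affv g p < w p) ->
  simplicial s w -> simplicial (p :: s) w.
Proof.
move=> ps high simp g fg; have [gw gspan] := fg.
have subs t : {subset t <= s} -> {subset t <= p :: s}.
  by move=> ts q /ts qs; rewrite inE qs orbT.
have := gw p (mem_head _ _); rewrite le_eqVlt => /orP[/eqP gp|gp]; last first.
  have [t [ts frt cE]] := simp g ((facet_fn_cons ps gp).1 fg).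
  by exists t; split=> //; [exact: subs | rewrite cell_cons].
have gws : below s w g by move=> q qs; apply: gw; rewrite inE qs orbT.
set G := touching s w g.
have pG : homog p \notin <<[seq homog q | q <- G]>>%VS.
  apply/negP => pG; suff /high : facet_fn s w g by rewrite gp ltxx.
  split=> //; move: gspan.
  by rewrite homog_span_cons //= gp eqxx homog_span_cons.
have [x xs] : exists x, x \in s.
  case: s ps {simp high fg gw gspan subs gws G pG} => [|x s'] ps; last first.
    by exists x; rewrite mem_head.
  by move: ps; rewrite span_nil memv0 /homog => /eqP[_ /eqP]; rewrite oner_eq0.
have [g' [[gw' gspan'] _ sub]] := raise_to_facet gws (sub_hull xs).
have [t [ts frt cE]] := simp g' (conj gw' gspan').
have h0 : {in touching s w g', forall v, 0 <= affv (g' - g) v}.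
  move=> v vt; rewrite !affvE (touchingP vt) subr_ge0.
  by apply: gws; exact: touching_sub vt.
have := simplex_face cE h0.
have -> : [seq v <- touching s w g' | affv (g' - g) v == 0] = G.
  rewrite -filter_predI; apply: eq_in_filter => v vs /=.
  apply/andP/idP => [[+ /eqP vt]|vg].
    by rewrite !affvE vt subr_eq0 eq_sym.
  have vG : v \in G by rewrite mem_filter vg.
  have := sub v vG; rewrite mem_filter => /andP[vg' _].
  by rewrite vg' !affvE subr_eq0 (eqP vg) (eqP vg').
set t' := [seq v <- t | _] => GE.
have spanE : <<[seq homog q | q <- t']>>%VS = <<[seq homog q | q <- G]>>%VS.
  apply/eqP; rewrite eqEsubv; apply/andP; split; apply: hull_sub_span.
    by rewrite GE; exact: sub_hull.
  by rewrite -GE; exact: sub_hull.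
exists (p :: t'); split.
- move=> q; rewrite inE => /orP[/eqP ->|]; first exact: mem_head.
  by rewrite mem_filter => /andP[_ /ts qs]; rewrite inE qs orbT.
- rewrite /= free_cons spanE pG /=.
  have := permEl (perm_filterC (fun v => affv (g' - g) v == 0) t).
  move=> /(perm_map (@homog _ _))/perm_free; rewrite frt.
  by rewrite map_cat => /catl_free.
rewrite /cell /= gp eqxx -/G.
have consS a b : hull [set` a] = hull [set` b] ->
    hull [set` p :: a] `<=` hull [set` p :: b].
  move=> ab; apply: hull_sub => v /=; rewrite inE => /orP[/eqP ->|va].
    by apply: sub_hull; rewrite /= mem_head.
  have : hull [set` b] v by rewrite -ab; exact: sub_hull.
  by apply: hullS => z /= zb; rewrite inE zb orbT.
by apply/seteqP; split; apply: consS.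
Qed.

(** Heights above every facet function exist because these take finitely many
    values at [p]. *)
Lemma rat_above_facet_fns s w p :
  homog p \in <<[seq homog q | q <- s]>>%VS ->
  exists r : rat, 0 <= r /\ forall g, facet_fn s w g -> affv g p < ratr r.
Proof.
move=> ps; have [vals valsP] := facet_fn_values_finite w ps.
pose M := \sum_(v <- vals) `|v|.
have M0 : 0 <= M by apply: sumr_ge0.
exists (Num.bound M)%:R; split=> // g /valsP gv.
rewrite ratr_nat; apply: le_lt_trans (archi_boundP M0).
apply: le_trans (ler_norm _) _; rewrite /M (big_rem _ gv) /= lerDl.
exact: sumr_ge0.
Qed.

Lemma simplicial_extension l s (w : V -> rat) :
  simplicial s (ratr \o w) -> {in s, forall p, 0 <= w p} ->
  {in l, forall p, homog p \in <<[seq homog q | q <- s]>>%VS} ->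
  exists s' (w' : V -> rat), [/\ s' =i l ++ s, {in s', forall p, 0 <= w' p},
    simplicial s' (ratr \o w')
    & forall g, facet_fn s (ratr \o w) g ->
        facet_fn s' (ratr \o w') g /\
        cell s' (ratr \o w') g = cell s (ratr \o w) g].
Proof.
elim: l s w => [|p l IH] s w simp w0 ls; first by exists s, w; split.
have ps := ls p (mem_head _ _).
have ls' : {in l, forall q, homog q \in <<[seq homog q | q <- s]>>%VS}.
  by move=> q ql; apply: ls; rewrite inE ql orbT.
have [pins|pnots] := boolP (p \in s).
  have [s' [w' [s'E ? ? ?]]] := IH s w simp w0 ls'.
  exists s', w'; split=> // q; rewrite s'E !inE !mem_cat.
  by case: eqP => [->|//]; rewrite pins orbT.
have [r [r0 high]] := rat_above_facet_fns (ratr \o w) ps.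
pose w1 q := if q == p then r else w q.
have eqw : {in s, ratr \o w =1 ratr \o w1 :> (V -> R)}.
  by move=> q qs; rewrite /w1 /=; case: eqP pnots => // <-; rewrite qs.
have w1p : (ratr \o w1) p = ratr r :> R by rewrite /w1 /= eqxx.
have high1 g : facet_fn s (ratr \o w1) g -> affv g p < (ratr \o w1) p.
  move=> fg; rewrite w1p; apply/high/(eq_facet_fn _ fg) => q qs.
  by rewrite eqw.
have simp1 := simplicial_cons ps high1 (eq_simplicial eqw simp).
have [||s' [w' [s'E w'0 simp' ext]]] := IH (p :: s) w1 simp1.
- by move=> q; rewrite /w1 inE; case: eqP => //= _ /w0.
- by move=> q ql; rewrite (homog_span_cons ps) ls'.
exists s', w'; split=> //.
  by move=> q; rewrite s'E !inE !mem_cat inE orbCA.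
move=> g fg; have fg1 := eq_facet_fn eqw fg.
have [f' cE] := ext g ((facet_fn_cons ps (high1 g fg1)).2 fg1).
split=> //; rewrite cE cell_cons ?high1 //.
by rewrite /cell (eq_touching _ eqw).
Qed.

End AddPoint.

(** * Affine rank as a linear dimension *)

Section AffineRank.
Variables (R : realType) (V : vectType R).
Implicit Types (s t : seq V) (x y : V).
Local Notation W := (V * R^o)%type.

Lemma dim_span_map_injective (U1 U2 : vectType R) (f : 'Hom(U1, U2)) (X : seq U1) :
  injective f -> \dim <<[seq f u | u <- X]>> = \dim <<X>>.
Proof.
move=> /lker0P kf; rewrite -limg_span; apply: limg_dim_eq.
by rewrite (eqP kf) capv0.
Qed.

(** Subtracting [homog x] from the other vectors changes neither the span nor the
    length of the list, and leaves vectors [(y - x, 0)] in a hyperplane that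
    does not contain [homog x]. *)
Lemma affinely_independentE s :
  affinely_independent s = free [seq homog v | v <- s].
Proof.
case: s => [|x s]; first by rewrite /= nil_free.
have lin : linear (fun v : V => (v, 0) : W).
  by move=> a u v; congr pair; rewrite /= scaler0 addr0.
pose flM := GRing.isLinear.Build _ _ _ _ (fun v : V => (v, 0) : W) lin.
pose fL : {linear V -> W} := HB.pack (fun v : V => (v, 0) : W) flM.
pose f := linfun fL.
have fE v : f v = (v, 0) by rewrite lfunE.
have fI : injective f by move=> u v; rewrite !fE => -[].
pose D := [seq f (y - x) | y <- s].
have homogE y : homog y = f (y - x) + homog x.
  by rewrite fE /homog; congr pair; rewrite /= ?subrK ?add0r.
have spanE : <<[seq homog v | v <- x :: s]>>%VS = <<homog x :: D>>%VS.
  rewrite /= !span_cons; apply/eqP; rewrite eqEsubv !subv_add !addvSl /=.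
  apply/andP; split; apply/span_subvP => _ /mapP[y ys ->].
    rewrite homogE addrC memv_add ?memv_line // memv_span //.
    by apply/mapP; exists y.
  rewrite -[f _](addrK (homog x)) -homogE addrC memv_add //.
    by rewrite memvN memv_line.
  by rewrite memv_span ?map_f.
have -> : free [seq homog v | v <- x :: s] = free (homog x :: D).
  by rewrite /free spanE /= !size_map.
have [h hE] := @hom_prod_exists _ V 0 1.
rewrite free_cons; have -> : homog x \notin <<D>>%VS.
  have sub : (<<D>> <= lker h)%VS.
    apply/span_subvP => _ /mapP[y ys ->].
    by rewrite memv_ker fE hE lfunE mul0r addr0.
  apply/negP => /(subvP sub).
  by rewrite memv_ker hE lfunE add0r mul1r oner_eq0.
rewrite /= /free /D (map_comp f (fun y => y - x)).
by rewrite (dim_span_map_injective _ fI) !size_map.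
Qed.

Lemma exists_affine_basis s : exists t, [/\ {subset t <= s},
  free [seq homog v | v <- t] &
  <<[seq homog v | v <- t]>>%VS = <<[seq homog v | v <- s]>>%VS].
Proof.
elim: s => [|x s [t [ts frt tE]]]; first by exists [::]; rewrite nil_free.
have [xt|xt] := boolP (homog x \in <<[seq homog v | v <- t]>>%VS).
  exists t; split=> //; first by move=> v /ts vs; rewrite inE vs orbT.
  by rewrite homog_span_cons -?tE.
exists (x :: t); split.
- by move=> v; rewrite !inE => /orP[->//|/ts ->]; rewrite orbT.
- by rewrite /= free_cons xt.
- by rewrite /= !span_cons tE.
Qed.

Lemma affine_rankE s (A : set V) : [set` s] `<=` A ->
  (forall x, A x -> homog x \in <<[seq homog v | v <- s]>>%VS) ->
  affine_rank A = \dim <<[seq homog v | v <- s]>>.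
Proof.
move=> sA As; apply/anti_leq/andP; split.
  apply/bigmax_leqP => k /asboolP[t [<- + tA]].
  rewrite affinely_independentE => /eqP; rewrite size_map => <-.
  apply: dimvS; apply/span_subvP => _ /mapP[v vt ->].
  by apply: As; apply: tA.
have [t [ts frt <-]] := exists_affine_basis s.
have := frt; rewrite /free => /eqP ->; rewrite size_map.
have sz : (size t < (\dim {:V}).+2)%N.
  move: frt; rewrite -affinely_independentE; case: t {ts} => //= x t.
  move=> /eqP; rewrite size_map => <-.
  by rewrite !ltnS dimvS ?subvf.
apply: (@leq_bigmax_cond _ _ (fun k : 'I_(\dim {:V}).+2 => nat_of_ord k) (Ordinal sz)).
apply/asboolP; exists t; split=> //; first by rewrite affinely_independentE.
by move=> v /ts vs; apply: sA.
Qed.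

Lemma affine_rank_hull s :
  affine_rank (hull [set` s]) = \dim <<[seq homog v | v <- s]>>.
Proof. by apply: affine_rankE => [|x]; [exact: sub_hull | exact: hull_span]. Qed.

Lemma affine_dim_hull s s' :
  affine_dim (hull [set` s]) = affine_dim (hull [set` s']) <->
  \dim <<[seq homog v | v <- s]>> = \dim <<[seq homog v | v <- s']>>.
Proof.
rewrite /affine_dim !affine_rank_hull; split=> [/addIr[] //|-> //].
Qed.

End AffineRank.

(** * Lower facets and cells *)

Section LowerFacets.
Variables (R : realType) (V : vectType R).
Implicit Types (s t : seq V) (x y p q : V) (w : V -> R).
Local Notation W := (V * R^o)%type.

Definition lift w s : seq W := [seq (p, w p : R^o) | p <- s].

Lemma lifted_seq s (w : V -> rat) :
  lifted [set` s] w = [set` lift (ratr \o w) s].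
Proof.
apply/seteqP; split=> z /=; first by move=> [p ps <-]; apply/mapP; exists p.
by move=> /mapP[p ps ->]; exists p.
Qed.

Lemma fst_hull_lift w s : fst @` hull [set` lift w s] = hull [set` s].
Proof.
apply/seteqP; split=> [_ [z zs <-]|x].
  apply: (zs [set y | hull [set` s] y.1]); split; last first.
    by move=> _ /mapP[p ps ->]; apply: sub_hull.
  move=> y y' l; rewrite !inE /= => ys y's.
  by have := @hull_convex _ _ [set` s] y.1 y'.1 l; rewrite !inE; apply.
move=> /hull_seqP[c [c0 xE]].
exists (x, \sum_(v <- s) c v * w v : R^o) => //.
apply/hull_seqP; exists (fun z => c z.1); split=> //.
move: xE; rewrite !homog_sum !big_map /= => -[-> cE]; rewrite /homog -cE.
congr (_, _); elim: (s) => [|v s1 IH]; first by rewrite !big_nil.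
by rewrite !big_cons -IH.
Qed.

(** On [s] the lift follows the graph of an affine function, so it extends to an
    injective linear map of homogeneous coordinates. *)
Lemma dim_span_lift s w g : {in s, forall p, affv g p = w p} ->
  \dim <<[seq homog z | z <- lift w s]>> = \dim <<[seq homog p | p <- s]>>.
Proof.
move=> gw; pose f (z : W) : (W * R^o)%type := ((z.1, g z), z.2).
have lin : linear f by move=> a y z; congr (_, _, _); rewrite /= linearP.
pose flM := GRing.isLinear.Build _ _ _ _ f lin.
pose fL : {linear W -> (W * R^o)%type} := HB.pack f flM.
have fE z : linfun fL z = f z by rewrite lfunE.
have fI : injective (linfun fL).
  by move=> [a b] [c d]; rewrite !fE /f /= => -[-> _ ->].
rewrite -(dim_span_map_injective _ fI) -!map_comp; congr (\dim <<_>>).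
by apply/eq_in_map => p ps; rewrite /comp fE /f -gw.
Qed.

(** The functional [u] exceeds its value on the graph of [g] by [b] times the
    height above that graph, so it is minimal where the polytope touches it. *)
Lemma face_of_lift s w g (u : 'Hom(W, R^o)) (l : 'Hom(V, R^o)) (b m : R) :
  0 < b -> (forall x (r : R), u (x, r) = l x + r * b) ->
  (forall x, b * affv g x = m - l x) ->
  below s w g -> touching s w g != [::] ->
  face_of u (hull [set` lift w s]) = hull [set` lift w (touching s w g)].
Proof.
move=> b0 uE gE gw tne.
have [k kE] := @hom_prod_exists _ W u (- m).
have kz z : affv k z = u z - m by rewrite /affv kE mul1r.
have klift p : affv k (p, w p) = b * (w p - affv g p).
  by rewrite kz uE mulrBr gE; ring.
have k0 : {in lift w s, forall z, 0 <= affv k z}.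
  by move=> _ /mapP[p ps ->]; rewrite klift mulr_ge0 ?subr_ge0 ?gw // ltW.
have subl : [set` lift w (touching s w g)] `<=` [set` lift w s].
  move=> _ /mapP[p pt ->]; apply/mapP; exists p => //; exact: touching_sub pt.
have kt : {in lift w (touching s w g), forall z, affv k z = 0}.
  by move=> _ /mapP[p pt ->]; rewrite klift (touchingP pt) subrr mulr0.
apply/seteqP; split=> z.
  move=> [zs zmin].
  have [q qt] : exists q, q \in touching s w g.
    by case: (touching s w g) tne => // q t _; exists q; rewrite mem_head.
  have {}qt : (q, w q : R^o) \in lift w (touching s w g).
    by apply/mapP; exists q.
  have kz0 : affv k z = 0.
    apply/le_anti; rewrite (affv_hull_ge0 k0 zs) andbT.
    rewrite -(kt _ qt) !kz lerD2r; apply: zmin.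
    by apply: sub_hull; apply: subl.
  have := hull_zero_face k0 zs kz0; apply: hullS => y /=.
  rewrite mem_filter => /andP[/eqP ky /mapP[p ps yE]].
  rewrite yE; apply/mapP; exists p => //; rewrite mem_filter ps andbT.
  move: ky; rewrite yE klift => /eqP; rewrite mulf_eq0 (gt_eqF b0) /= subr_eq0.
  by rewrite eq_sym.
move=> zt; have zs := hullS subl zt; split=> // y ys.
have : affv k z = 0.
  apply/le_anti; rewrite (affv_hull_ge0 k0 zs) andbT -oppr_ge0 -affvN.
  by apply: affv_hull_ge0 zt => v vt; rewrite affvN kt ?oppr0.
rewrite kz => /eqP; rewrite subr_eq0 => /eqP ->.
by have := affv_hull_ge0 k0 ys; rewrite kz subr_ge0.
Qed.

Lemma affine_dim_lower_face s w g :
  affine_dim (hull [set` lift w (touching s w g)]) =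
    affine_dim (hull [set` s]) <->
  <<[seq homog p | p <- touching s w g]>>%VS = <<[seq homog p | p <- s]>>%VS.
Proof.
rewrite /affine_dim !affine_rank_hull (@dim_span_lift _ _ g); last first.
  by move=> p; exact: touchingP.
split=> [/addIr[] dimE|-> //]; apply/eqP; rewrite eqEdim dimE leqnn andbT.
by apply: sub_homog_span; exact: touching_sub.
Qed.

(** A functional [u = l + b * t] with [b > 0] and minimum [m] on the lifted points
    corresponds to the minorant [(m - l) / b]; conversely, a minorant [g] is
    the case [b = 1] with [u] the height above the graph of [g]. *)
Lemma lower_facet_cells s (w : V -> rat) : s != [::] ->
  [set fst @` F | F in lower_facet [set` s] w] =
  [set cell s (ratr \o w) g | g in facet_fn s (ratr \o w)].
Proof.
move=> sne; set w' := ratr \o w; apply/seteqP.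
split=> [_ [F [u [b0 -> dimF]] <-]|_ [g [gw gspan] <-]].
  have [l uE] := hom_prodE u; set b := u (0, 1) in b0 uE.
  have [|q [qs _ qmin]] := @seq_argmin _ _ (fun p => l p + w' p * b : R) predT s.
    by rewrite has_predT lt0n size_eq0.
  pose m : R := l q + w' q * b.
  have [g gE] := @hom_prod_exists _ V (- b^-1 *: l) (m / b).
  have gE' x : b * affv g x = m - l x.
    rewrite /affv gE mul1r scale_lfunE -[_ *: l x]/(_ * (l x : R)).
    by field; rewrite gt_eqF.
  have gw' : below s w' g.
    move=> p ps; rewrite -(ler_pM2l b0) gE' lerBlDl [b * _]mulrC.
    exact: qmin.
  have gq : q \in touching s w' g.
    rewrite mem_filter qs andbT -(inj_eq (mulfI (lt0r_neq0 b0))) gE' /m.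
    by rewrite addrAC subrr add0r mulrC.
  have tne : touching s w' g != [::] by apply/eqP => tE; rewrite tE in gq.
  move: dimF; rewrite lifted_seq (face_of_lift b0 uE gE' gw' tne) => dimF.
  by exists g; [split=> //; apply/affine_dim_lower_face | rewrite fst_hull_lift].
have [l lE] := hom_prodE g.
have [u uE] := @hom_prod_exists _ V (- l) 1.
have gE' x : 1 * affv g x = g (0, 1) - (- l) x.
  by rewrite /affv lE !mul1r opp_lfunE opprK addrC.
have tne : touching s w' g != [::].
  apply/eqP => tE; move: gspan; rewrite tE /= span_nil.
  case: s sne {gw tE} => // p s _ /esym; rewrite /= span_cons => H.
  have : homog p \in (0%VS : {vspace W}).
    by rewrite -H; apply: (subvP (addvSl _ _)); exact: memv_line.
  by rewrite memv0 => /eqP[_ /eqP]; rewrite oner_eq0.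
exists (hull [set` lift w' (touching s w' g)]); last exact: fst_hull_lift.
exists u; split.
- by rewrite uE linear0 add0r mul1r.
- by rewrite lifted_seq (face_of_lift ltr01 uE gE' gw tne).
- exact/affine_dim_lower_face.
Qed.

Lemma regular_triangulation_cells s (w : V -> rat) : s != [::] ->
  {in s, forall p, 0 <= w p} -> simplicial s (ratr \o w) ->
  regular_triangulation [set` s]
    [set cell s (ratr \o w) g | g in facet_fn s (ratr \o w)].
Proof.
move=> sne w0 simp; split; last first.
  by exists w => //; rewrite lower_facet_cells.
split.
- move=> _ [g fg <-]; split.
    have [t [ts frt cE]] := simp g fg; exists t; split=> //.
    by rewrite affinely_independentE.
  by apply/affine_dim_hull; have [_ ->] := fg.
- move=> _ _ [g [gw _] <-] [g' [gw' _] <-]; split; first exact: cell_cap_face.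
  by rewrite setIC; exact: cell_cap_face.
- apply/seteqP; split=> x.
    by move=> [_ [g fg <-]]; apply: hullS => p; exact: touching_sub.
  by move=> /(cells_cover simp)[g fg xg]; exists (cell s (ratr \o w) g) => //; exists g.
Qed.

End LowerFacets.

(** * Extending a regular triangulation *)

Theorem lemma4p5 (R : realType) (V : vectType R) (N : set V)
    (hN : is_lattice N) (L0 L1 L : set V)
    (fin0 : finite_set L0) (fin1 : finite_set L1)
    (lat0 : L0 `<=` N) (lat1 : L1 `<=` N)
    (hL : L = L0 `|` L1)
    (hdim : affine_dim (hull L0) = affine_dim (hull L))
    (T0 : set (set V)) (hT0 : regular_triangulation L0 T0) :
  exists T : set (set V), regular_triangulation L T /\ T0 `<=` T.
Proof.
have [s sE] := (finite_seqP L0).1 fin0; have [l lE] := (finite_seqP L1).1 fin1.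
have LE : L = [set` l ++ s].
  rewrite hL sE lE; apply/seteqP; split=> x /=; rewrite mem_cat.
    by move=> [->|->//]; rewrite orbT.
  by move=> /orP[xl|xs]; [right|left].
move: hdim; rewrite LE sE => /affine_dim_hull dimE.
have spanE : <<[seq homog v | v <- s]>>%VS = <<[seq homog v | v <- l ++ s]>>%VS.
  apply/eqP; rewrite eqEdim dimE leqnn andbT; apply: sub_homog_span => v vs.
  by rewrite mem_cat vs orbT.
have ls : {in l, forall p, homog p \in <<[seq homog q | q <- s]>>%VS}.
  by move=> p pl; rewrite spanE memv_span // map_f // mem_cat pl.
have [s0|sne] := eqVneq s [::].
  exists T0; split=> //; case: l ls {lE LE dimE spanE} => [|p l] ls.
    by rewrite -sE.
  have := ls p (mem_head _ _); rewrite s0 /= span_nil memv0.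
  by move=> /eqP[_ /eqP]; rewrite oner_eq0.
move: hT0; rewrite sE => -[[simplT0 _ _] [w w0 T0E]].
rewrite lower_facet_cells // in T0E.
have simp : simplicial s (ratr \o w).
  move=> g fg; have [|[t [tai ts cE]] _] := simplT0 (cell s (ratr \o w) g).
    by rewrite T0E; exists g.
  by exists t; split=> //; rewrite -affinely_independentE.
have [s' [w' [s'E w'0 simp' ext]]] := simplicial_extension simp w0 ls.
exists [set cell s' (ratr \o w') g | g in facet_fn s' (ratr \o w')]; split.
  have -> : [set` l ++ s] = [set` s'].
    by apply/seteqP; split=> x /=; rewrite s'E.
  apply: regular_triangulation_cells => //.
  apply/eqP => s'0; case/negP: sne; rewrite -size_eq0 -leqn0 leqNgt.
  rewrite -has_predT; apply/hasPn => p ps.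
  by have := s'E p; rewrite s'0 mem_cat ps orbT.
rewrite T0E => _ [g fg <-]; have [f' cE] := ext g fg.
by exists g.
Qed.
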